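(* Let $T$ be a labelled tree on $n$ vertices and let $A\in M_n(\mathbb{R})$ be $T$-positive. If $\det A>0$, then for all $1\le i,j\le n$, $$\operatorname{sign}(\det A(i;j))=(-1)^{i+j}\sigma_i\sigma_j,$$ where $\sigma=(\sigma_1,\dots,\sigma_n)$ is signed according to $T$.
   Context: A labelled tree $T$ on $n$ vertices has vertex set $\{1,\dots,n\}$. A pendent vertex is a vertex of degree 1. A real square matrix is totally positive (TP) if all its minors are positive, and is a P-matrix if all its principal minors are positive. For an ordered index list $\alpha$ of distinct elements of $\{1,\dots,n\}$, $A[\alpha]$ is the principal submatrix of $A$ with rows and columns indexed by $\alpha$, arranged in the order given by $\alpha$. For a path $\mathscr{P}$ in $T$, $A[\mathscr{P}]$ means $A[\alpha]$ where $\alpha$ lists the vertices of $\mathscr{P}$ in the order in which they appear along $\mathscr{P}$ (the direction is immaterial). $A(i;j)$ is the $(n-1)\times(n-1)$ submatrix of $A$ obtained by deleting row $i$ and column $j$, keeping the natural order, and $A(i)=A(i;i)$. $A\in M_n(\mathbb{R})$ is T-TP if $A[\mathscr{P}]$ is TP for each path $\mathscr{P}$ of $T$ connecting two pendent vertices. $A$ is pendent-$P$ relative to $T$ if all principal submatrices associated with the deletion of pendent vertices (i.e. $A(p)$ for $p$ a pendent vertex of $T$) are P-matrices. $A$ is $T$-positive if it is both T-TP and pendent-$P$ relative to $T$. A vector $\sigma\in\{1,-1\}^n$ is signed according to $T$ if $\sigma_i=-\sigma_j$ whenever $i$ and $j$ are adjacent in $T$; such $\sigma$ is unique up to multiplication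 by $\pm1$. *)

(* Defs.v *)
(* World: MathComp, with MathComp-Analysis' [realType] for the real numbers. *)
From mathcomp Require Import all_boot all_order all_algebra.
From mathcomp Require Import reals.

Set Implicit Arguments.
Unset Strict Implicit.
Unset Printing Implicit Defensive.

Import Order.TTheory GRing.Theory Num.Theory.
Local Open Scope ring_scope.

(* Vertices are numbered 0, ..., n-1 instead of 1, ..., n.  [ucycle e c] means
   that [c] lists pairwise distinct vertices, cyclically adjacent; sizes 1 and 2
   are excluded because every edge yields such a [c] of size 2. *)
Record is_tree (n : nat) (e : rel 'I_n) : Prop := IsTree {
  tree_nonempty : (0 < n)%N;
  tree_sym : symmetric e;
  tree_irrefl : irreflexive e;
  tree_connected : forall x y : 'I_n, connect e x y;
  tree_acyclic : forall c : seq 'I_n, (2 < size c)%N -> ~ ucycle e c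
}.

Definition degree (n : nat) (e : rel 'I_n) (x : 'I_n) : nat :=
  #|[set y | e x y]|.

Definition pendent (n : nat) (e : rel 'I_n) (x : 'I_n) : Prop :=
  degree e x = 1%N.

(* A choice of k rows (or columns) in their natural order. *)
Definition increasing (k m : nat) (f : 'I_k -> 'I_m) : Prop :=
  forall i j : 'I_k, (i < j)%N -> (f i < f j)%N.

Definition totally_positive (R : realType) (m : nat) (B : 'M[R]_m) : Prop :=
  forall (k : nat) (f g : 'I_k -> 'I_m),
    increasing f -> increasing g -> 0 < \det (mxsub f g B).

Definition P_matrix (R : realType) (m : nat) (B : 'M[R]_m) : Prop :=
  forall (k : nat) (f : 'I_k -> 'I_m),
    increasing f -> 0 < \det (mxsub f f B).

(* A[s]: rows and columns arranged in the order in which they occur in s. *)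
Definition ordered_submx (R : realType) (n : nat) (A : 'M[R]_n)
    (s : seq 'I_n) : 'M[R]_(size s) :=
  mxsub (tnth (in_tuple s)) (tnth (in_tuple s)) A.

(* A(i;j): row i and column j deleted. *)
Definition deleted_submx (R : realType) (n : nat) (A : 'M[R]_n)
    (i j : 'I_n) : 'M[R]_n.-1 :=
  row' i (col' j A).

(* The path has successive vertices x :: p. *)
Definition T_TP (R : realType) (n : nat) (e : rel 'I_n) (A : 'M[R]_n) : Prop :=
  forall (x : 'I_n) (p : seq 'I_n),
    path e x p -> uniq (x :: p) ->
    pendent e x -> pendent e (last x p) -> x != last x p ->
    totally_positive (ordered_submx A (x :: p)).

Definition pendent_P (R : realType) (n : nat) (e : rel 'I_n) (A : 'M[R]_n)
    : Prop :=
  forall p : 'I_n, pendent e p -> P_matrix (deleted_submx A p p).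

Definition T_positive (R : realType) (n : nat) (e : rel 'I_n) (A : 'M[R]_n)
    : Prop :=
  T_TP e A /\ pendent_P e A.

Definition signed_according_to (R : realType) (n : nat) (e : rel 'I_n)
    (s : 'rV[R]_n) : Prop :=
  (forall i : 'I_n, s 0 i = 1 \/ s 0 i = -1) /\
  (forall i j : 'I_n, e i j -> s 0 i = - s 0 j).

(* Main.v *)
Require Import Defs.
From mathcomp Require Import all_boot all_order all_algebra.
From mathcomp Require Import reals.
From mathcomp Require Import ring lra zify.

Set Implicit Arguments.
Unset Strict Implicit.
Unset Printing Implicit Defensive.

Import Order.TTheory GRing.Theory Num.Theory.
Local Open Scope ring_scope.

(** Up to the factor [\det A > 0] and a transposition, the signed minor
    [(-1) ^+ (i + j) * \det A(i;j)] is an entry of the inverse of [A].  With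
    [b i j := sigma_i * sigma_j * (A^-1) i j], the claim is therefore that every
    [b i j] is positive ([inverse_signed]), and this is proved by induction on
    the number of vertices.

    Let [p] be a pendent vertex.  Deleting it leaves a smaller tree
    ([tree_delete_leaf]) for which [A(p)] is again positive
    ([T_positive_delete_leaf]), and [\det A(p) > 0] because [A(p)] is a
    P-matrix; so the induction hypothesis describes the signs of [A(p)^-1].
    But [A(p)^-1] is the Schur complement of the entry [(p, p)] in [A^-1]
    ([invmx_row'_col']), so the induction hypothesis reads
      [b i p * b p j < b i j * b p p]  for all [i, j != p],
    for every pendent [p], while [b p p = \det A(p) / \det A > 0].

    When the tree has three pendent vertices, these inequalities alone force
    all the [b i j] to be positive ([leaf_dominant_gt0]).  The key point is
    that the row of [b] at a vertex [i] cannot be nonpositive at two pendent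
    vertices [p] and [q] other than [i] ([leaf_dominant_row2]): the
    inequalities at [p] and at [q] would bound [b p q * b q p] from below by
    [b p p * b q q], whereas the inequality at [p] for the entry [(q, q)] is the
    opposite strict bound.

    A tree without three pendent vertices is a path through all vertices
    ([tree_path_or_three_leaves]).  Then [A], reordered along that path, is
    totally positive, its inverse has the checkerboard sign pattern, and the
    checkerboard is exactly the alternation of [sigma] along the path
    ([hamiltonian_path_inverse_signed]). *)

(** * Positivity from domination at the leaves *)

Section LeafDominance.

Variables (R : realFieldType) (I : eqType) (L : I -> Prop).

(** The second clause says that, for every pivot [b p p] at a leaf [p], the
    Schur complement of that pivot has only positive entries. *)
Definition leaf_dominant (b : I -> I -> R) : Prop :=
  (forall p, L p -> 0 < b p p) /\
  (forall p i j, L p -> i != p -> j != p -> b i p * b p j < b i j * b p p).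

Lemma leaf_dominantC (b : I -> I -> R) :
  leaf_dominant b -> leaf_dominant (fun i j => b j i).
Proof.
move=> [bpp bij]; split=> // p i j Lp ip jp; rewrite mulrC; exact: bij.
Qed.

(** If [b i p] and [b i q] were both nonpositive, the inequalities for the
    entries [(i, q)] with pivot [p] and [(i, p)] with pivot [q] would first make
    them negative, and then their product would give
    [b p p * b q q < b p q * b q p], contradicting positivity of the entry
    [(q, q)] of the Schur complement at [p]. *)
Lemma leaf_dominant_row2 (b : I -> I -> R) (i p q : I) :
    leaf_dominant b -> L p -> L q -> p != q -> i != p -> i != q ->
  b i p <= 0 -> 0 < b i q.
Proof.
move=> [bpp bij] Lp Lq pq ip iq bip; rewrite ltNge; apply/negP => biq.
have bp := bpp p Lp; have bq := bpp q Lq.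
have qp : q != p by rewrite eq_sym.
have h1 := bij q i p Lq iq pq.
have h2 := bij p i q Lp ip qp.
have h3 := bij p q q Lp qp qp.
have {}biq : b i q < 0 by rewrite lt_neqAle biq andbT; apply/eqP => z; nra.
have {}bip : b i p < 0 by rewrite lt_neqAle bip andbT; apply/eqP => z; nra.
have iq0 : 0 < - b i q by lra.
have ip0 : 0 < - b i p by lra.
have y0 := mulr_gt0 ip0 bq; have w0 := mulr_gt0 iq0 bp.
(* [h1] and [h2] compare negative numbers; their negations can be multiplied. *)
have lt_prod : - b i p * b q q * (- b i q * b p p) <
    - b i q * b q p * (- b i p * b p q).
  apply: ltr_pM; [exact: ltW|exact: ltW|lra|lra].
have := mulr_gt0 iq0 ip0.
nra.
Qed.

Hypothesis many_leaves : forall i j : I, exists r, [/\ L r, i != r & j != r].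

(** If [b p q <= 0], a third leaf [r] has [b p r > 0] (row [p]) and [b r q > 0]
    (column [q]), whereas the inequality at [r] makes their product negative. *)
Lemma leaf_dominant_leaves (b : I -> I -> R) (p q : I) :
  leaf_dominant b -> L p -> L q -> 0 < b p q.
Proof.
move=> bD Lp Lq; have [<-|pq] := eqVneq p q; first exact: bD.1.
have [r [Lr pr qr]] := many_leaves p q.
rewrite ltNge; apply/negP => bpq.
have h1 := leaf_dominant_row2 bD Lq Lr qr pq pr bpq.
have qp : q != p by rewrite eq_sym.
have h2 := leaf_dominant_row2 (leaf_dominantC bD) Lp Lr pr qp qr bpq.
have h3 := bD.2 r p q Lr pr qr.
have := bD.1 r Lr; nra.
Qed.

(** If [b i p <= 0], another leaf [q] has [b i q > 0], and [b q p > 0] since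
    both are leaves; the inequality at [q] bounds their product by a
    nonpositive number. *)
Lemma leaf_dominant_row (b : I -> I -> R) (i p : I) :
  leaf_dominant b -> L p -> 0 < b i p.
Proof.
move=> bD Lp; have [->|ip] := eqVneq i p; first exact: bD.1.
have [q [Lq iq pq]] := many_leaves i p.
rewrite ltNge; apply/negP => bip.
have h1 := leaf_dominant_row2 bD Lp Lq pq ip iq bip.
have h2 := leaf_dominant_leaves bD Lq Lp.
have h3 := bD.2 q i p Lq iq pq.
have := bD.1 q Lq; nra.
Qed.

Lemma leaf_dominant_gt0 (b : I -> I -> R) (i j : I) :
  leaf_dominant b -> 0 < b i j.
Proof.
move=> bD; have [p [Lp ip jp]] := many_leaves i j.
have h1 := leaf_dominant_row i bD Lp.
have h2 := leaf_dominant_row j (leaf_dominantC bD) Lp.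
have h3 := bD.2 p i j Lp ip jp.
have h4 := bD.1 p Lp.
by rewrite ltNge; apply/negP => ?; nra.
Qed.

End LeafDominance.

(** * Pendent vertices and their deletion *)

Lemma pendentP n (e : rel 'I_n) (x : 'I_n) :
  pendent e x <-> exists y, forall z, e x z = (z == y).
Proof.
rewrite /pendent /degree; split=> [/eqP/cards1P[y xy]|[y xy]].
  by exists y => z; have /setP/(_ z) := xy; rewrite !inE.
by apply/eqP/cards1P; exists y; apply/setP => z; rewrite !inE.
Qed.

Section Trees.

Variables (n : nat) (e : rel 'I_n).
Hypothesis tree_e : is_tree e.

(** A path that cannot be extended beyond its end stops at a pendent vertex: an
    edge from the end back to a vertex of the path other than the neighbouring
    one closes a cycle. *)
Lemma path_closed_pendent (x : 'I_n) (s : seq 'I_n) :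
    path e x s -> uniq (x :: s) -> (0 < size s)%N ->
    (forall w, e x w -> w \in x :: s) ->
  pendent e x.
Proof.
case: s => // y s /= /andP[exy ys] us _ cl.
apply/pendentP; exists y => z; apply/idP/eqP => [exz|-> //].
have := cl z exz; rewrite !inE => /or3P[/eqP zx|/eqP //|zs].
  by move: exz; rewrite zx (tree_irrefl tree_e).
case/splitPr: zs ys us => s1 s2 ys us.
case: (tree_acyclic tree_e (c := x :: y :: rcons s1 z)).
  by rewrite /= size_rcons.
rewrite -[_ && _]/(uniq (x :: y :: (s1 ++ z :: s2))) in us.
move: ys us; rewrite -cat_rcons -!cat_cons cat_path cat_uniq => /andP[ys1 _].
case/andP=> us _; apply/andP; split=> //.
by rewrite /= rcons_path exy ys1 last_rcons (tree_sym tree_e).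
Qed.

Lemma path_last_closed_pendent (x : 'I_n) (s : seq 'I_n) :
    path e x s -> uniq (x :: s) -> (0 < size s)%N ->
    (forall w, e (last x s) w -> w \in x :: s) ->
  pendent e (last x s).
Proof.
move=> xs us s0 cl; apply: (@path_closed_pendent _ (rev (belast x s))).
- rewrite rev_path (eq_path (e' := e)) // => u v.
  exact: (tree_sym tree_e).
- by rewrite -rev_rcons -lastI rev_uniq.
- by rewrite size_rev size_belast.
- by move=> w /cl; rewrite -rev_rcons -lastI mem_rev.
Qed.

(** A path through at least one edge is extended until it cannot be. *)
Lemma exists_pendent : (1 < n)%N -> exists p, pendent e p.
Proof.
move=> n1.
(* [k] bounds the number of vertices that can still be added. *)
suff ext k x s : (n <= k + size s)%N -> path e x s -> uniq (x :: s) ->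
    (0 < size s)%N -> exists p, pendent e p.
  pose x0 := Ordinal (ltnW n1); pose x1 := Ordinal n1.
  have /connectP[[|y s] /=] := tree_connected tree_e x0 x1.
    by move=> _ /(congr1 val).
  case/andP=> exy _ _; apply: (ext n x0 [:: y]) => //=.
  - by rewrite leq_addr.
  - by rewrite exy.
  - rewrite inE andbT; apply/eqP => yx.
    by move: exy; rewrite yx (tree_irrefl tree_e).
elim: k x s => [|k IH] x s nk xs us s0.
  have := uniq_leq_size us (fun z _ => mem_enum 'I_n z).
  by rewrite size_enum_ord /=; lia.
have [cl|] := boolP [forall w, e x w ==> (w \in x :: s)].
  exists x; apply: (path_closed_pendent xs us s0) => w.
  exact/implyP/(forallP cl).
case/forallPn=> w; rewrite negb_imply => /andP[exw wxs].
apply: (IH w (x :: s)) => //=; first by rewrite addnS -addSn.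
- by rewrite (tree_sym tree_e) exw.
- by rewrite wxs.
Qed.

End Trees.

Definition delete_vertex n (e : rel 'I_n) (p : 'I_n) : rel 'I_n.-1 :=
  fun x y => e (lift p x) (lift p y).

Section LeafRemoval.

Variables (n : nat) (e : rel 'I_n) (p q : 'I_n).
Hypotheses (tree_e : is_tree e) (p_q : forall z, e p z = (z == q)).

Let e_pq : e p q. Proof. by rewrite p_q. Qed.

Let q_neq_p : q != p.
Proof.
by apply/eqP => qp; have := e_pq; rewrite qp (tree_irrefl tree_e).
Qed.

(** Connectedness is the delicate point.  The map sending the pendent vertex [p]
    to its neighbour [q] and fixing the other vertices contracts the edge [p q]
    and preserves the other edges, so it carries walks of the tree to walks that
    avoid [p]. *)
Lemma tree_delete_leaf : is_tree (delete_vertex e p).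
Proof.
have [q' _ qE] : {k : 'I_n.-1 | q = lift p k & unlift p q = Some k}.
  by apply: unlift_some; rewrite eq_sym.
pose r v := odflt q' (unlift p v).
have rp : r p = q' by rewrite /r unlift_none.
have rq : r q = q' by rewrite /r qE.
have rl k : r (lift p k) = k by rewrite /r liftK.
have step u v : e u v -> connect (delete_vertex e p) (r u) (r v).
  case: (unliftP p u) => [u'|] ->; case: (unliftP p v) => [v'|] ->.
  - by rewrite !rl => h; apply: connect1.
  - by rewrite (tree_sym tree_e) p_q => /eqP ->; rewrite rp rq.
  - by rewrite p_q => /eqP ->; rewrite rp rq.
  - by rewrite (tree_irrefl tree_e).
split.
- by case: q' {qE r rp rq rl step} => m; case: (n.-1).
- by move=> x y; apply: (tree_sym tree_e).
- by move=> x; apply: (tree_irrefl tree_e).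
- move=> x y; rewrite -(rl x) -(rl y).
  have /connectP[s + ->] := tree_connected tree_e (lift p x) (lift p y).
  elim: s (lift p x) => [|z s IH] u //= /andP[/step uz /IH].
  exact: connect_trans.
- move=> c c2 /andP[cyc uc].
  apply: (tree_acyclic tree_e (c := map (lift p) c)); first by rewrite size_map.
  apply/andP; split; last by rewrite map_inj_uniq //; apply: lift_inj.
  case: c cyc {c2 uc} => //= x s.
  by rewrite -map_rcons path_map.
Qed.

Lemma pendent_delete_leaf (x : 'I_n.-1) :
  pendent (delete_vertex e p) x -> lift p x != q -> pendent e (lift p x).
Proof.
move=> /pendentP[y xy] xq; apply/pendentP; exists (lift p y) => z.
case: (unliftP p z) => [z'|] ->.
  by rewrite (inj_eq (@lift_inj _ p)) -xy.
by rewrite (tree_sym tree_e) p_q (negbTE xq) (negbTE (neq_lift _ _)).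
Qed.

End LeafRemoval.

(** By induction, deleting a pendent vertex [p] attached to [q].  If the smaller
    tree has three pendent vertices, at least two of them differ from [q] and
    remain pendent, and [p] is the third.  If it is a path, either [q] is an end
    of it and [p] prolongs the path, or both ends remain pendent and [p] is the
    third. *)
Lemma tree_path_or_three_leaves n (e : rel 'I_n) : is_tree e ->
  (exists x s, [/\ path e x s, uniq (x :: s) & forall z, z \in x :: s]) \/
  (exists x y z, [/\ pendent e x, pendent e y & pendent e z] /\
                 uniq [:: x; y; z]).
Proof.
elim: n e => [|n IH] e tree_e; first by have := tree_nonempty tree_e.
have [n0|n0] := posnP n.
  left; exists ord0, [::]; split=> // z; rewrite inE.
  by apply/eqP/val_inj; case: z => /= m; rewrite n0; case: m.
have [p pP] := exists_pendent tree_e (n0 : (1 < n.+1)%N).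
have [q pq] := (pendentP e p).1 pP.
have epq : e p q by rewrite pq.
have pl k : p != lift p k by apply: neq_lift.
case: (IH _ (tree_delete_leaf tree_e pq)) => [[x [s [xs us cov]]]|]; last first.
  case=> x [y [z [[xP yP zP] /=]]].
  rewrite !inE negb_or andbT => /andP[/andP[xy xz] yz].
  right.
  have two u v : pendent (delete_vertex e p) u ->
      pendent (delete_vertex e p) v -> u != v ->
      lift p u != q -> lift p v != q ->
      exists x y z, [/\ pendent e x, pendent e y & pendent e z] /\
                 uniq [:: x; y; z].
    move=> uP vP uv uq vq; exists p, (lift p u), (lift p v).
    split; first by split=> //; apply: (pendent_delete_leaf tree_e pq).
    by rewrite /= !inE !negb_or !pl (inj_eq (@lift_inj _ p)) uv.
  have [xq|xq] := eqVneq (lift p x) q.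
    by apply: (two y z) => //; rewrite -xq (inj_eq (@lift_inj _ p)) eq_sym.
  have [yq|yq] := eqVneq (lift p y) q; last exact: (two x y).
  by apply: (two x z) => //; rewrite -yq (inj_eq (@lift_inj _ p)) eq_sym.
have tree_e' := tree_delete_leaf tree_e pq.
have liftxs : path e (lift p x) (map (lift p) s) by rewrite path_map.
have liftus : uniq (map (lift p) (x :: s)).
  by rewrite map_inj_uniq //; apply: lift_inj.
have pNs : p \notin map (lift p) (x :: s).
  by apply/mapP => -[k _ /eqP]; rewrite (negbTE (pl k)).
have cov' z : z \in p :: map (lift p) (x :: s).
  rewrite inE; case: (unliftP p z) => [z'|] ->; last by rewrite eqxx.
  by rewrite (mem_map (@lift_inj _ p)) cov orbT.
have [xq|xq] := eqVneq (lift p x) q.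
  left; exists p, (map (lift p) (x :: s)); split=> //=.
  - by rewrite xq epq -xq.
  - by move: pNs liftus => /= -> ->.
have [lq|lq] := eqVneq (lift p (last x s)) q.
  left; exists (lift p x), (rcons (map (lift p) s) p); split.
  - by rewrite rcons_path liftxs last_map lq (tree_sym tree_e).
  - by rewrite -rcons_cons rcons_uniq pNs.
  - by move=> z; rewrite -rcons_cons mem_rcons cov'.
right; exists p, (lift p x), (lift p (last x s)).
(* A one-vertex path would consist of [q], an end excluded by [xq]. *)
have s0 : (0 < size s)%N.
  case: s {xs us liftxs liftus pNs cov'} cov lq => //= cov _.
  have : unlift p q.
    by case: unliftP => // qp; move: epq; rewrite qp (tree_irrefl tree_e).
  case: unliftP => // k qk _; move: (cov k) xq; rewrite inE qk => /eqP ->.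
  by rewrite eqxx.
split.
  split=> //; apply: (pendent_delete_leaf tree_e pq) => //.
  - exact: (path_closed_pendent tree_e' xs us s0).
  - exact: (path_last_closed_pendent tree_e' xs us s0).
rewrite /= !inE !negb_or !pl (inj_eq (@lift_inj _ p)) !andbT.
case: s s0 us {xs liftxs liftus pNs cov cov' lq} => //= y s _ /andP[xys _].
by apply: contraNneq xys => ->; apply: mem_last.
Qed.

(** * Schur complements in the inverse *)

(** Inverting [A] with row and column [p] deleted amounts to taking the Schur
    complement of the entry [(p, p)] in the inverse of [A]: the correction term
    cancels what the deleted column contributes to [A *m invmx A]. *)
Lemma invmx_row'_col' (F : fieldType) n (A : 'M[F]_n) (p : 'I_n) :
    A \in unitmx -> invmx A p p != 0 ->
  forall i j, invmx (row' p (col' p A)) i j =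
    invmx A (lift p i) (lift p j)
    - invmx A (lift p i) p * invmx A p (lift p j) / invmx A p p.
Proof.
move=> uA; set B := invmx A => Bpp.
pose C : 'M[F]_n.-1 :=
  \matrix_(i, j) (B (lift p i) (lift p j)
                   - B (lift p i) p * B p (lift p j) / B p p).
suff AC : row' p (col' p A) *m C = 1%:M.
  move=> i j; have [uA' _] := mulmx1_unit AC.
  by rewrite -[invmx _]mulmx1 -AC mulKmx // !mxE.
have AB i j : \sum_k A (lift p i) (lift p k) * B (lift p k) j =
    (lift p i == j)%:R - A (lift p i) p * B p j.
  have /matrixP/(_ (lift p i) j) := mulmxV uA.
  rewrite !mxE (bigD1_ord p) //= => <-.
  by rewrite -/B [RHS]addrC addKr.
apply/matrixP => i j; rewrite !mxE.
under eq_bigr => k _ do rewrite !mxE mulrBr !mulrA.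
rewrite sumrB AB -!mulr_suml AB (eq_sym _ p) (negbTE (neq_lift _ _)).
rewrite (inj_eq (@lift_inj _ p)) sub0r !mulNr opprK.
by rewrite -!mulrA [B p p * _]mulrC divfK // subrK.
Qed.

(** The bridge from a signed positive entry of the Schur complement to
    [leaf_dominant]; the sign [sp] of the pivot occurs squared. *)
Lemma signed_schur_lt (R : realFieldType) (si sj sp bij bip bpj bpp : R) :
    sp * sp = 1 -> 0 < bpp -> 0 < si * sj * (bij - bip * bpj / bpp) ->
  si * sp * bip * (sp * sj * bpj) < si * sj * bij * bpp.
Proof.
move=> sp2 bpp0 /(mulr_gt0 bpp0).
rewrite mulrCA mulrBr [bpp * (_ / _)]mulrC divfK ?gt_eqF // => schur.
rewrite -subr_gt0.
suff -> : si * sj * bij * bpp - si * sp * bip * (sp * sj * bpj) =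
    si * sj * (bpp * bij - bip * bpj * (sp * sp)) by rewrite sp2 mulr1.
by ring.
Qed.

Lemma invmx_entry (R : realType) n (A : 'M[R]_n) (i j : 'I_n) :
  A \in unitmx ->
  invmx A j i = (\det A)^-1 * ((-1) ^+ (i + j) * \det (deleted_submx A i j)).
Proof. by move=> uA; rewrite /invmx uA !mxE. Qed.

(** * Inheritance of positivity by the smaller tree *)

Lemma totally_positive_mxsub (R : realType) k m (h : 'I_k -> 'I_m)
    (B : 'M[R]_m) :
  increasing h -> totally_positive B -> totally_positive (mxsub h h B).
Proof.
move=> inc_h B_TP l f g inc_f inc_g; rewrite -mxsub_comp.
by apply: B_TP => i j ij; [apply/inc_h/inc_f | apply/inc_h/inc_g].
Qed.

Lemma P_matrix_mxsub (R : realType) k m (h : 'I_k -> 'I_m) (B : 'M[R]_m) :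
  increasing h -> P_matrix B -> P_matrix (mxsub h h B).
Proof.
move=> inc_h B_P l f inc_f; rewrite -mxsub_comp.
by apply: B_P => i j ij; apply/inc_h/inc_f.
Qed.

Lemma increasing_lift m (p : 'I_m) : increasing (lift p).
Proof. by move=> i j; rewrite /= /bump; lia. Qed.

Lemma det_P_matrix (R : realType) m (B : 'M[R]_m) : P_matrix B -> 0 < \det B.
Proof. by move/(_ m id (fun _ _ => id)); rewrite mxsub_id. Qed.

(** The form needed for deletion of a leaf [p]: a path that avoids [p] may have
    to be prolonged by [p], at either end, before positivity is known. *)
Lemma totally_positive_infix (R : realType) n (A : 'M[R]_n) (p : 'I_n)
    (s : seq 'I_n.-1) (t1 t2 : seq 'I_n) :
  totally_positive (ordered_submx A (t1 ++ map (lift p) s ++ t2)) ->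
  totally_positive (ordered_submx (deleted_submx A p p) s).
Proof.
set t := t1 ++ _.
have h_lt (i : 'I_(size s)) : (size t1 + i < size t)%N.
  by rewrite !size_cat size_map ltn_add2l ltn_addr.
pose h i := Ordinal (h_lt i).
have hE i : tnth (in_tuple t) (h i) = lift p (tnth (in_tuple s) i).
  have y := tnth (in_tuple s) i.
  rewrite (tnth_nth (lift p y)) (tnth_nth y) /= nth_cat ltnNge leq_addr /=.
  by rewrite addKn nth_cat size_map ltn_ord (nth_map y).
suff <- : mxsub h h (ordered_submx A t) =
          ordered_submx (deleted_submx A p p) s.
  by apply: totally_positive_mxsub => i j ij; rewrite ltn_add2l.
by apply/matrixP => i j; rewrite !mxE !hE.
Qed.

(** A path between pendent vertices of the smaller tree is a path between
    pendent vertices of the tree, unless one of its ends is the neighbour [q] of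
    [p], which may have become pendent by the deletion; then adding [p] to it
    gives such a path. *)
Lemma T_positive_delete_leaf (R : realType) n (e : rel 'I_n) (A : 'M[R]_n)
    (p : 'I_n) :
  is_tree e -> pendent e p -> T_positive e A ->
  T_positive (delete_vertex e p) (deleted_submx A p p).
Proof.
move=> tree_e pP [A_TP A_P]; split; last first.
  move=> x _; rewrite /deleted_submx row'Esub col'Esub -mxsub_comp /=.
  by apply: P_matrix_mxsub; [apply: increasing_lift | apply: A_P].
have [q pq] := (pendentP e p).1 pP.
have epq : e p q by rewrite pq.
have pl k : p != lift p k by apply: neq_lift.
have liftP := pendent_delete_leaf tree_e pq.
move=> x s xs us xP lP xl.
have xs' : path e (lift p x) (map (lift p) s) by rewrite path_map.
have us' : uniq (map (lift p) (x :: s)).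
  by rewrite map_inj_uniq //; apply: lift_inj.
have pNs : p \notin map (lift p) (x :: s).
  by apply/mapP => -[k _ /eqP]; rewrite (negbTE (pl k)).
have [xq|xq] := eqVneq (lift p x) q.
  apply: (@totally_positive_infix _ _ _ _ _ [:: p] [::]); rewrite cats0.
  have lq : lift p (last x s) != q.
    by rewrite -xq (inj_eq (@lift_inj _ p)) eq_sym.
  apply: A_TP => //=; rewrite ?last_map //.
  - by rewrite xq epq -xq.
  - by move: pNs us' => /= -> ->.
  - exact: liftP.
have [lq|lq] := eqVneq (lift p (last x s)) q.
  apply: (@totally_positive_infix _ _ _ _ _ [::] [:: p]); rewrite cat0s cats1.
  apply: A_TP; rewrite ?last_rcons.
  - by rewrite rcons_path xs' last_map lq (tree_sym tree_e).
  - by rewrite -rcons_cons rcons_uniq pNs.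
  - exact: liftP.
  - exact: pP.
  - by rewrite eq_sym.
apply: (@totally_positive_infix _ _ _ p _ [::] [::]); rewrite cat0s cats0.
apply: A_TP; rewrite ?last_map //; try exact: liftP.
by rewrite (inj_eq (@lift_inj _ p)).
Qed.

(** * Trees that are paths *)

Lemma totally_positive_invmx (R : realType) m (B : 'M[R]_m) (i j : 'I_m) :
  totally_positive B -> 0 < (-1) ^+ (i + j) * invmx B i j.
Proof.
move=> B_TP; have detB : 0 < \det B.
  by apply: det_P_matrix => k f inc_f; apply: B_TP.
rewrite invmx_entry ?unitmxE ?unitfE ?gt_eqF // mulrCA addnC.
rewrite signrMK mulr_gt0 ?invr_gt0 // /deleted_submx row'Esub col'Esub.
by rewrite -mxsub_comp; apply: B_TP; apply: increasing_lift.
Qed.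

Lemma invmx_mxsub_bij (F : fieldType) m n (f : 'I_m -> 'I_n) (A : 'M[F]_n) :
  bijective f -> A \in unitmx -> invmx (mxsub f f A) = mxsub f f (invmx A).
Proof.
move=> f_bij uA.
suff AB : mxsub f f A *m mxsub f f (invmx A) = 1%:M.
  by have [uB _] := mulmx1_unit AB; rewrite -[LHS]mulmx1 -AB mulKmx.
apply/matrixP => i j; rewrite !mxE.
have /matrixP/(_ (f i) (f j)) := mulmxV uA.
rewrite !mxE (bij_eq f_bij) => <-.
rewrite (reindex f) /=; last exact: onW_bij.
by apply: eq_bigr => k _; rewrite !mxE.
Qed.

Lemma signed_along_path (R : realType) n (e : rel 'I_n) (sigma : 'rV[R]_n)
    (x : 'I_n) (s : seq 'I_n) (i : nat) :
  signed_according_to e sigma -> path e x s -> (i <= size s)%N ->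
  sigma 0 (nth x (x :: s) i) = (-1) ^+ i * sigma 0 x.
Proof.
move=> [_ alt] /(pathP x) xs; elim: i => [|i IH] i_s; first by rewrite mul1r.
rewrite exprS -mulrA -IH ?(ltnW i_s) // mulN1r.
by rewrite (alt _ _ (xs i i_s)) opprK.
Qed.

Lemma signed_mul_id (R : realType) n (e : rel 'I_n) (sigma : 'rV[R]_n) i :
  signed_according_to e sigma -> sigma 0 i * sigma 0 i = 1.
Proof. by move=> [/(_ i)[] -> _]; rewrite ?mulr1 // mulrNN mulr1. Qed.

Lemma hamiltonian_path_inverse_signed (R : realType) n (e : rel 'I_n)
    (A : 'M[R]_n) (sigma : 'rV[R]_n) (x : 'I_n) (s : seq 'I_n) :
    signed_according_to e sigma -> A \in unitmx ->
    path e x s -> uniq (x :: s) -> (forall z, z \in x :: s) ->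
    totally_positive (ordered_submx A (x :: s)) ->
  forall i j, 0 < sigma 0 i * sigma 0 j * invmx A i j.
Proof.
move=> sgn uA xs us cov A_TP.
pose f := tnth (in_tuple (x :: s)).
have f_bij : bijective f.
  apply: inj_card_bij; first exact/tuple_uniqP.
  by rewrite !card_ord -[X in (X <= _)%N]size_enum_ord uniq_leq_size ?enum_uniq.
have [g fg gf] := f_bij.
move=> i j; rewrite -(gf i) -(gf j).
have := totally_positive_invmx (g i) (g j) A_TP.
rewrite /ordered_submx (invmx_mxsub_bij f_bij uA) mxE.
have sE k : sigma 0 (f k) = (-1) ^+ k * sigma 0 x.
  rewrite /f (tnth_nth x) (signed_along_path sgn xs) //.
  by rewrite -ltnS ltn_ord.
by rewrite !sE mulrACA (signed_mul_id x sgn) mulr1 exprD.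
Qed.

(** * Signs of the inverse *)

Lemma signed_delete_vertex (R : realType) n (e : rel 'I_n) (sigma : 'rV[R]_n)
    (p : 'I_n) :
  signed_according_to e sigma ->
  signed_according_to (delete_vertex e p) (\row_i sigma 0 (lift p i)).
Proof.
move=> [pm alt]; split=> [i|i j eij]; rewrite !mxE; first exact: pm.
exact: alt.
Qed.

Theorem inverse_signed (R : realType) n (e : rel 'I_n) (A : 'M[R]_n)
    (sigma : 'rV[R]_n) :
    is_tree e -> T_positive e A -> signed_according_to e sigma ->
    0 < \det A ->
  forall i j, 0 < sigma 0 i * sigma 0 j * invmx A i j.
Proof.
elim: n e A sigma => [|n IH] e A sigma tree_e A_pos sgn detA i j.
  by case: i.
have uA : A \in unitmx by rewrite unitmxE unitfE gt_eqF.
have Adiag p : pendent e p -> 0 < invmx A p p.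
  move=> /A_pos.2/det_P_matrix detAp.
  rewrite invmx_entry // addnn -signr_odd odd_double mul1r.
  by rewrite mulr_gt0 ?invr_gt0.
have [[x [s [xs us cov]]]|[x [y [z [[xP yP zP] /=]]]]] :=
  tree_path_or_three_leaves tree_e.
  have [s0|s0] := posnP (size s).
    (* A single vertex is not pendent; here the only entry is [1 / \det A],
       because the complementary minor is empty. *)
    have i_x k : k = x.
      by have := cov k; rewrite (size0nil s0) inE => /eqP.
    rewrite (i_x i) (i_x j) (signed_mul_id x sgn) mul1r invmx_entry //.
    rewrite addnn -signr_odd odd_double mul1r mulr_gt0 ?invr_gt0 //.
    have n0 : n = 0%N.
      case: n x i_x {IH e A sigma tree_e A_pos sgn detA uA Adiag
        i j s xs us cov s0} => // n x i_x.
      by have := congr1 val (etrans (i_x ord0) (esym (i_x ord_max))).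
    by move: (deleted_submx A x x); rewrite /= n0 => M; rewrite det_mx00.
  apply: (hamiltonian_path_inverse_signed sgn uA xs us cov) => //.
  apply: A_pos.1 => //.
  - apply: (path_closed_pendent tree_e xs us s0) => w _; exact: cov.
  - apply: (path_last_closed_pendent tree_e xs us s0) => w _; exact: cov.
  - case: s s0 us {xs cov} => //= y s _ /andP[xys _].
    by apply: contraNneq xys => ->; apply: mem_last.
rewrite !inE negb_or andbT => /andP[/andP[xy xz] yz].
apply: (@leaf_dominant_gt0 _ _ (pendent e) _
         (fun i j => sigma 0 i * sigma 0 j * invmx A i j)) => [k l|].
  (* One of the three pendent vertices differs from both [k] and [l]. *)
  have [xk|xk] := eqVneq x k; have [xl|xl] := eqVneq x l.
  - by exists y; rewrite -xk -xl xy.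
  - have [yl|yl] := eqVneq y l; last by exists y; rewrite -xk xy eq_sym.
    by exists z; rewrite -xk -yl.
  - have [yk|yk] := eqVneq y k; last by exists y; rewrite -xl xy eq_sym.
    by exists z; rewrite -xl -yk.
  - by exists x; rewrite ![_ == x]eq_sym.
split=> [p pP|p k l pP]; first by rewrite (signed_mul_id p sgn) mul1r Adiag.
case: (unliftP p k) => [k' ->|->]; last by rewrite eqxx.
case: (unliftP p l) => [l' ->|->]; last by rewrite eqxx.
move=> _ _.
have [q pq] := (pendentP e p).1 pP.
have := IH _ _ _ (tree_delete_leaf tree_e pq)
  (T_positive_delete_leaf tree_e pP A_pos) (signed_delete_vertex p sgn)
  (det_P_matrix (A_pos.2 p pP)) k' l'.
have Bpp := Adiag p pP.
have pp0 : invmx A p p != 0 by rewrite gt_eqF.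
rewrite (invmx_row'_col' uA pp0 k' l') !mxE (signed_mul_id p sgn) mul1r.
exact: signed_schur_lt (signed_mul_id p sgn) Bpp.
Qed.

Theorem theorem4 (R : realType) (n : nat) (e : rel 'I_n) (A : 'M[R]_n)
    (sigma : 'rV[R]_n) (tree_e : is_tree e) (A_pos : T_positive e A)
    (sigma_signed : signed_according_to e sigma) (detA_gt0 : 0 < \det A)
    (i j : 'I_n) :
  Num.sg (\det (deleted_submx A i j))
    = (-1) ^+ (i + j) * sigma 0 i * sigma 0 j.
Proof.
have uA : A \in unitmx by rewrite unitmxE unitfE gt_eqF.
have := inverse_signed tree_e A_pos sigma_signed detA_gt0 j i.
rewrite (invmx_entry i j uA) mulrCA pmulr_rgt0 ?invr_gt0 //.
set M := \det _; rewrite mulrCA mulrA => h.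
have [sij|sij] : (-1) ^+ (i + j) * (sigma 0 j * sigma 0 i) = 1
    \/ (-1) ^+ (i + j) * (sigma 0 j * sigma 0 i) = -1 :> R.
  rewrite -signr_odd; case: odd;
  by case: (sigma_signed.1 i) => ->; case: (sigma_signed.1 j) => ->;
    rewrite ?(mulr1, mul1r, mulrNN, mulN1r, opprK, expr0, expr1); auto.
- rewrite -mulrA [sigma 0 i * _]mulrC sij gtr0_sg //.
  by move: h; rewrite sij mul1r.
- rewrite -mulrA [sigma 0 i * _]mulrC sij ltr0_sg //.
  by move: h; rewrite sij mulN1r oppr_gt0.
Qed.
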